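(* Let $(X_1,\mathcal A_1)$ and $(X_2,\mathcal A_2)$ be standard Borel spaces, and let $P:X_1\times\mathcal A_2\to[0,1]$ be a probability transition kernel. Suppose that $\nu_1$ is a Borel $\sigma$-finite measure on $(X_1,\mathcal A_1)$. Then there exist a Borel $\sigma$-finite measure $\rho$ on $Z=X_1\times X_2$, a Borel $\sigma$-finite measure $\nu_2$ on $(X_2,\mathcal A_2)$, and a transition kernel $Q:X_2\times\mathcal A_1\to[0,1]$ such that $\rho\circ\pi_i^{-1}=\nu_i$, $i=1,2$, $$d\nu_1(x)P(x,dy)=d\nu_2(y)Q(y,dx),$$ and $$\nu_1P=\nu_2,\qquad \nu_2Q=\nu_1 .$$ The objects $\rho,\nu_2$ and $Q$ are uniquely defined by $P$ and $\nu_1$.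
   Context: $\pi_i:X_1\times X_2\to X_i$ is the natural projection. A map $R:X\times\mathcal A'\to[0,\infty)$ (with $(X,\mathcal A)$, $(X',\mathcal A')$ standard Borel) is a transition kernel if $x\mapsto R(x,C)$ is Borel for every $C\in\mathcal A'$ and $C\mapsto R(x,C)$ is a $\sigma$-finite Borel measure for every $x\in X$; it is a probability transition kernel if $R(x,X')=1$ for every $x$. A kernel acts on measures by $(\mu R)(C)=\int_XR(x,C)\,d\mu(x)$. The equality $d\nu_1(x)P(x,dy)=d\nu_2(y)Q(y,dx)$ means that the two sides define the same measure on $X_1\times X_2$, this measure being $\rho$: $\rho(A\times B)=\int_AP(x,B)\,d\nu_1(x)=\int_BQ(y,A)\,d\nu_2(y)$ for $A\in\mathcal A_1$, $B\in\mathcal A_2$. Uniqueness of the kernel $Q$ is understood as uniqueness of disintegration, i.e. up to a $\nu_2$-null set of $y$.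
   Formalization: The formal theorem additionally assumes that ν₁P is σ-finite; without this the claim fails (ν₁ Lebesgue on ℝ, P(x,·)=δ₀ gives ν₁P=∞·δ₀), and the conclusion ν₁P=ν₂ with ν₂ σ-finite forces it. *)

(* Defs.v *)
From HB Require Import structures.
From mathcomp Require Import all_boot all_order all_algebra.
From mathcomp Require Import all_classical all_reals all_analysis.

Set Implicit Arguments.
Unset Strict Implicit.
Unset Printing Implicit Defensive.

Import Order.TTheory GRing.Theory Num.Theory.

Local Open Scope classical_set_scope.
Local Open Scope ring_scope.
Local Open Scope ereal_scope.

Definition separable (T : topologicalType) : Prop :=
  exists2 D : set T, countable D & dense D.

(* No library structure joins [metricType] with completeness. *)
Definition complete_metric (R : realType) (T : metricType R) : Prop :=
  forall F : set_system T, ProperFilter F -> cauchy F ->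
    exists x : T, F --> x.

(* The sigma-algebra of [T] is the Borel sigma-algebra of a Polish topology,
   here transported to [T] along the bijection [f]. *)
Definition standard_borel (R : realType) (d : measure_display)
    (T : measurableType d) : Prop :=
  exists (M : metricType R) (f : T -> M),
    [/\ separable M, complete_metric M, bijective f &
      forall A : set T, measurable A <-> (<<s @open M >>) (f @` A)].

(* Not sigma-finite in general even if [mu] is and [K] is a probability kernel,
   e.g. the Lebesgue measure and a constant Dirac kernel. *)
Definition kernel_act (R : realType) (d d' : measure_display)
    (X : measurableType d) (Y : measurableType d')
    (mu : {measure set X -> \bar R}) (K : R.-ker X ~> Y) (C : set Y) : \bar R :=
  \int[mu]_x K x C.

(* The equation [nu1(dx) P(x, dy) = nu2(dy) Q(y, dx)], i.e. both sides are the
   measure [rho], tested on measurable rectangles. *)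
Definition disintegrates (R : realType) (d1 d2 : measure_display)
    (X1 : measurableType d1) (X2 : measurableType d2)
    (nu1 : {measure set X1 -> \bar R}) (P : R.-ker X1 ~> X2)
    (rho : {measure set (X1 * X2)%type -> \bar R})
    (nu2 : {measure set X2 -> \bar R}) (Q : R.-ker X2 ~> X1) : Prop :=
  forall (A : set X1) (B : set X2), measurable A -> measurable B ->
    rho (A `*` B) = \int[nu1]_(x in A) P x B /\
    rho (A `*` B) = \int[nu2]_(y in B) Q y A.

Definition dual_system (R : realType) (d1 d2 : measure_display)
    (X1 : measurableType d1) (X2 : measurableType d2)
    (nu1 : {measure set X1 -> \bar R}) (P : R.-ker X1 ~> X2)
    (rho : {measure set (X1 * X2)%type -> \bar R})
    (nu2 : {measure set X2 -> \bar R}) (Q : R.-ker X2 ~> X1) : Prop :=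
  [/\ forall A : set X1, measurable A -> pushforward rho fst A = nu1 A,
      forall B : set X2, measurable B -> pushforward rho snd B = nu2 B,
      disintegrates nu1 P rho nu2 Q,
      forall B : set X2, measurable B -> kernel_act nu1 P B = nu2 B &
      forall A : set X1, measurable A -> kernel_act nu2 Q A = nu1 A].

(* Main.v *)
Require Import Defs.
From HB Require Import structures.
From mathcomp Require Import all_boot all_order all_algebra.
From mathcomp Require Import all_classical all_reals all_analysis.
From mathcomp Require Import measurable_realfun lra.

(* The measure [rho] is the semidirect product of [nu1] and [P], and [nu2] is its
   second marginal; the point is the disintegration of [rho] along [nu2].
   A standard Borel space is a Borel retract of the line, which
   replaces [X1] by a nonnegative real function [f] on it. For each rational [q]
   the measure [B |-> rho ({f < q} * B)] has a density [phi_q] with respect to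
   [nu2]. Instead of correcting the [phi_q] on null sets into a distribution
   function, the conditional law at [y] is taken to be the law, under the Lebesgue
   measure, of the quantile function [u |-> inf {q | u < phi_q y}]. It gives to
   ]-oo, t[ the mass [sup {phi_q y | q < t}], and this supremum is a density for
   [{f < t}] because a maximum of densities of nested sets is a density of the
   larger one. *)

Set Implicit Arguments.
Unset Strict Implicit.
Unset Printing Implicit Defensive.

Import Order.TTheory GRing.Theory Num.Theory.
Import numFieldNormedType.Exports.

Local Open Scope classical_set_scope.
Local Open Scope ring_scope.

(** * Standard Borel spaces as retracts of the line *)

Section ternary_code.
Context {R : realType}.
Implicit Types b : nat -> bool.

Definition tdigit b (k : nat) : R := (b k)%:R * (2 / 3 ^+ k.+1).

(** The point of the Cantor set with ternary digits 0 and 2. The gaps make the digits readable by a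
    threshold, without the ambiguity of dyadic expansions. *)
Definition tcode b : R := limn (series (tdigit b)).

(** On the Cantor set this deletes the leading ternary digit; the threshold 1/2 lies in the middle
    gap, between 1/3 and 2/3. *)
Definition tshift (t : R) : R :=
  if 2^-1 <= t then 3 * t - 2 else 3 * t.

Definition tdecode (n : nat) (t : R) : bool := 2^-1 <= iter n tshift t.

Lemma tdigit_ge0 b k : 0 <= tdigit b k.
Proof. by rewrite /tdigit mulr_ge0// divr_ge0// exprn_ge0. Qed.

Lemma is_cvg_tdigit b : cvgn (series (tdigit b)).
Proof.
apply: (@series_le_cvg _ _ (geometric (2 / 3 : R) (3^-1))).
- exact: tdigit_ge0.
- by move=> n; rewrite /= mulr_ge0// ?divr_ge0// exprn_ge0// invr_ge0.
- move=> n; rewrite /tdigit /geometric /= exprS exprVn invfM mulrA.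
  by case: (b n); rewrite /= ?mul1r ?mulrA// !mul0r !mulr_ge0// invr_ge0// exprn_ge0.
- have := @is_cvg_geometric_series R (2 / 3) 3^-1; apply.
  by rewrite ger0_norm ?invr_ge0//; lra.
Qed.

Lemma tcode_ge0 b : 0 <= tcode b.
Proof.
apply: limr_ge; first exact: is_cvg_tdigit.
by apply: nearW => n; apply: sumr_ge0 => k _; exact: tdigit_ge0.
Qed.

Lemma tcode_le1 b : tcode b <= 1.
Proof.
apply: limr_le; first exact: is_cvg_tdigit.
apply: nearW => n.
(* The bound is the partial sum with all digits equal to 2, a form that passes through the
   induction. *)
suff : series (tdigit b) n <= 1 - 3^-1 ^+ n.
  by move=> /le_trans; apply; rewrite gerBl exprn_ge0// invr_ge0.
rewrite /series /=; elim: n => [|n IH].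
  by rewrite big_geq// expr0 subrr.
rewrite big_nat_recr//= exprS.
have h : tdigit b n <= 2 * (3^-1 * 3^-1 ^+ n).
  rewrite /tdigit exprS invfM exprVn; set c := _ * (3 ^+ n)^-1.
  have c0 : 0 <= c by rewrite mulr_ge0// invr_ge0// exprn_ge0.
  by case: (b n); rewrite /= ?mul1r// mul0r mulr_ge0.
have : 0 <= 3^-1 ^+ n :> R by rewrite exprn_ge0// invr_ge0.
lra.
Qed.

Lemma tcode_rec b : tcode b = (2 * (b 0%N)%:R + tcode (b \o succn)) / 3.
Proof.
have h1 : (series (tdigit b)) n.+1 @[n --> \oo] --> tcode b.
  have : series (tdigit b) n @[n --> \oo] --> tcode b by exact: is_cvg_tdigit.
  by rewrite -cvg_shiftS.
have h2 : (2 * (b 0%N)%:R) / 3 + series (tdigit (b \o succn)) n / 3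
    @[n --> \oo] --> (2 * (b 0%N)%:R) / 3 + tcode (b \o succn) / 3.
  apply: cvgD; first exact: cvg_cst.
  by apply: cvgM; [exact: is_cvg_tdigit|exact: cvg_cst].
rewrite mulrDl -(cvg_lim _ h1)// -(cvg_lim _ h2)//; congr (limn _).
apply/funext => n; rewrite /series /= big_nat_recl//= {1}/tdigit expr1.
rewrite mulrCA mulrA; congr (_ + _); rewrite big_distrl/=.
apply: eq_bigr => k _; rewrite /tdigit/= exprS invfM -!mulrA.
by congr (_ * (_ * _)); rewrite mulrC.
Qed.

Lemma tcode_head b : (2^-1 <= tcode b) = b 0%N.
Proof.
have h0 := tcode_ge0 (b \o succn); have h1 := tcode_le1 (b \o succn).
rewrite tcode_rec; case: (b 0%N) => /=; last first.
  by apply/negbTE; rewrite -ltNge; lra.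
by lra.
Qed.

Lemma tshift_tcode b : tshift (tcode b) = tcode (b \o succn).
Proof.
rewrite /tshift tcode_head tcode_rec; case: (b 0%N) => /=; lra.
Qed.

Lemma tcodeK n b : tdecode n (tcode b) = b n.
Proof.
rewrite /tdecode; elim: n b => [|n IH] b; first exact: tcode_head.
by rewrite iterSr tshift_tcode IH.
Qed.

Lemma measurable_tshift : measurable_fun [set: R] tshift.
Proof.
apply: measurable_fun_ifT.
- by apply: measurable_fun_ler.
- apply: measurable_funB => //; exact: measurable_funM.
- exact: measurable_funM.
Qed.

Lemma measurable_tdecode n : measurable [set t | tdecode n t].
Proof.
have mi : measurable_fun [set: R] (iter n tshift).
  elim: n => [|n IH]; first exact: measurable_id.
  exact: (measurableT_comp measurable_tshift IH).
rewrite [X in measurable X](_ : _ = [set: R] `&` iter n tshift @^-1` `[2^-1, +oo[).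
  exact: mi.
by rewrite setTI; apply/seteqP; split => t; rewrite /tdecode/= in_itv/= andbT.
Qed.

Lemma measurable_tcode d (T : measurableType d) (U : nat -> set T) :
  (forall n, measurable (U n)) ->
  measurable_fun [set: T] (fun x => tcode (fun n => x \in U n)).
Proof.
move=> mU.
apply: (@measurable_fun_cvg _ _ _ _
  (fun n x => series (tdigit (fun n => x \in U n)) n)) => [n|x _].
  apply: measurable_sum => k; apply: measurable_funM => //.
  rewrite (_ : (fun x => _) = \1_(U k)); first exact: measurable_indic.
  by apply/funext => x; rewrite indicE.
exact: is_cvg_tdigit.
Qed.

End ternary_code.

Section first_index.
Implicit Types P : pred nat.

(** The default [d] makes the search total: [center] needs a value also at reals that code no
    point. *)
Definition first_index P (d : nat) : nat :=
  if pselect (exists i, P i) is left h then ex_minn h else d.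

Lemma first_indexP P d : (exists i, P i) -> P (first_index P d).
Proof.
by move=> h; rewrite /first_index; case: pselect => // h'; case: ex_minnP.
Qed.

Lemma first_index_dflt P d : P (first_index P d) \/ first_index P d = d.
Proof.
rewrite /first_index; case: pselect => [h|_]; last by right.
by left; case: ex_minnP.
Qed.

Lemma measurable_first_index d' (T : measurableType d') (P : T -> pred nat)
    (d i : nat) :
  (forall j, measurable [set t | P t j]) ->
  measurable [set t | first_index (P t) d = i].
Proof.
move=> mP.
pose A j := [set t | P t j].
have mU : measurable (\bigcup_j A j) by exact: bigcupT_measurable.
have mUi : measurable (\bigcup_(j in `I_i) A j) by apply: bigcup_measurable => j _; exact: mP.
(* The value is [i] when [i] is the first hit; for [i = d] the event of no hit at all is added. *)
rewrite [X in measurable X](_ : _ = (A i `\` \bigcup_(j in `I_i) A j) `|`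
    (if i == d then ~` \bigcup_j A j else set0)); last first.
  apply/seteqP; split => t /=; rewrite /first_index; case: pselect => h.
  - case: ex_minnP => k Pk mink <-; left; split => // -[j /= jk Pj].
    by have := mink _ Pj; rewrite leqNgt jk.
  - by move=> <-; right; rewrite eqxx => -[j _ Pj]; apply: h; exists j.
  - case: ex_minnP => k Pk mink [[Pi ni]|].
      apply/eqP; rewrite eqn_leq mink//= leqNgt; apply/negP => ki.
      by apply: ni; exists k.
    by case: ifP => // _; case; exists k.
  - move=> [[Pi _]|]; first by case: h; exists i.
    by case: ifP => [/eqP ->|_ []].
apply: measurableU; first by apply: measurableD => //; exact: mP.
by case: ifP => // _; exact: measurableC.
Qed.

End first_index.

(** * Coding the points of a complete separable metric space by reals *)

Lemma metric_ball_open (R : realType) (M : metricType R) (x : M) (e : R) :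
  open (ball x e).
Proof.
rewrite openE => y; rewrite ballEmdist /= => xy.
apply/nbhs_ballP; exists (e - mdist x y); first by rewrite /= subr_gt0.
move=> z; rewrite !ballEmdist /= => yz.
by rewrite (le_lt_trans (metric_triangle x y z))// -ltrBrDl.
Qed.

Lemma separable_seq (R : realType) (M : metricType R) (x0 : M) :
  separable M -> exists c : nat -> M,
    forall x (e : R), 0 < e -> exists i, ball (c i) e x.
Proof.
move=> [D cD dD].
have hD x (e : R) : 0 < e -> exists2 z, D z & ball z e x.
  move=> e0; have [|z [xz Dz]] := dD _ _ (metric_ball_open x e).
    by exists x; exact: ballxx.
  by exists z => //; exact: ball_sym.
case/pfcard_geP : cD => [D0|[c]].
  by have [z] := hD x0 1 ltr01; rewrite D0.
exists c => x e e0; have [z Dz xz] := hD x e e0.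
by have [i _ ci] := @surj _ _ _ _ c z Dz; exists i; rewrite ci.
Qed.

Section borel_retract.
Context {R : realType} {M : metricType R} (c : nat -> M).
Hypothesis cdense : forall x (e : R), 0 < e -> exists i, ball (c i) e x.
Hypothesis Mcomplete : complete_metric M.

Definition rad (m : nat) : R := 2^-1 ^+ m.

Lemma rad_gt0 m : 0 < rad m.
Proof. by rewrite exprn_gt0// invr_gt0. Qed.

Lemma radS m : rad m = 2 * rad m.+1.
Proof. by rewrite /rad exprS mulrA divff// mul1r. Qed.

Lemma rad_cvg0 (e : R) : 0 < e -> exists m, rad m < e.
Proof.
move=> e0; have h : rad m @[m --> \oo] --> (0 : R).
  by apply: cvg_expr; rewrite ger0_norm ?invr_ge0// invf_lt1// ltr1n.
move/cvgrPdist_lt : h => /(_ _ e0) [m _ /(_ m (leqnn m))].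
by rewrite sub0r normrN ger0_norm ?ltW ?rad_gt0// => ?; exists m.
Qed.

Definition cell (k : nat) : set M :=
  if (unpickle k : option (nat * nat)) is Some (m, i) then ball (c i) (rad m)
  else set0.

Lemma open_cell k : open (cell k).
Proof.
rewrite /cell; case: unpickle => [[m i]|]; last exact: open0.
exact: metric_ball_open.
Qed.

Definition hit (m i : nat) (t : R) : bool := tdecode (pickle (m, i)) t.

(** The ball condition bounds each move by [2 * rad m'], and the center stays put when no candidate
    qualifies, so the centers form a Cauchy sequence for every real [t], not only for codes of
    points. *)
Fixpoint center (m : nat) (t : R) : nat :=
  if m is m'.+1 then
    first_index (fun i => hit m i t &&
      `[< ball (c (center m' t)) (2 * rad m') (c i) >]) (center m' t)
  else first_index (hit 0 ^~ t) 0%N.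

Lemma measurable_center m i : measurable [set t | center m t = i].
Proof.
elim: m i => [|m IH] i.
  by apply: measurable_first_index => j; exact: measurable_tdecode.
(* Splitting along the value [p] of the previous center makes the ball condition independent of
   [t]. *)
rewrite [X in measurable X](_ : _ = \bigcup_p ([set t | center m t = p] `&`
  [set t | first_index (fun i => hit m.+1 i t &&
    `[< ball (c p) (2 * rad m) (c i) >]) p = i])); last first.
  apply/seteqP; split => t /=.
    by move=> h; exists (center m t).
  by move=> [p _ [/= <-]].
apply: bigcupT_measurable => p; apply: measurableI; first exact: IH.
apply: measurable_first_index => j.
case: asboolP => _ /=; last first.
  by rewrite (_ : mkset _ = set0)//; apply/seteqP; split => t //=; rewrite andbF.
by under eq_set do rewrite andbT; exact: measurable_tdecode.
Qed.

Lemma center_step m t : ball (c (center m t)) (2 * rad m) (c (center m.+1 t)).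
Proof.
have [] := first_index_dflt (fun i => hit m.+1 i t &&
  `[< ball (c (center m t)) (2 * rad m) (c i) >]) (center m t).
  by move=> /andP[_ /asboolP].
by move=> /= ->; apply: ballxx; rewrite mulr_gt0// rad_gt0.
Qed.

(** The moves add up geometrically: [2 * rad m + 4 * rad m.+1 = 4 * rad m], whence the induction on
    [k] with [m] free. *)
Lemma center_ball m k t :
  ball (c (center m t)) (4 * rad m) (c (center (m + k) t)).
Proof.
elim: k m => [|k IH] m.
  by rewrite addn0; apply: ballxx; rewrite mulr_gt0// rad_gt0.
have := ball_triangle (center_step m t) (IH m.+1).
by rewrite addSnnS; apply: le_ball; rewrite [in leRHS]radS radS; lra.
Qed.

Lemma center_cvg t : exists x : M, c (center m t) @[m --> \oo] --> x.
Proof.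
apply: Mcomplete; apply: cauchy_exP => e e0.
have [m me] := @rad_cvg0 (e / 4) ltac:(by rewrite divr_gt0).
exists (c (center m t)); exists m => // n /= mn.
have := center_ball m (n - m) t; rewrite subnKC//.
by apply: le_ball; lra.
Qed.

Definition decode (t : R) : M := sval (cid (center_cvg t)).

(** The bound [4 * rad m] on the later centers passes to the limit at the price of one more
    [rad m]. *)
Lemma decode_ball m t : ball (c (center m t)) (5 * rad m) (decode t).
Proof.
have := svalP (cid (center_cvg t)); rewrite -/(decode t) => h.
have /cvg_ballP/(_ _ (rad_gt0 m)) := h => -[k _ /(_ (m + k)%N) /=].
rewrite leq_addl => /(_ isT)/ball_sym; have := center_ball m k t.
move=> /ball_triangle h1 /h1; apply: le_ball.
lra.
Qed.

(** Since [U] is open, [decode t] lies in it exactly when, for some [m], the ball of radius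
    [5 * rad m] around the center does; only countably many centers occur. *)
Lemma decode_preimage_open (U : set M) : open U -> measurable (decode @^-1` U).
Proof.
move=> oU.
rewrite (_ : decode @^-1` U = \bigcup_m \bigcup_(i in
    [set i | ball (c i) (5 * rad m) `<=` U]) [set t | center m t = i]).
  apply: bigcupT_measurable => m; apply: bigcup_measurable => i _.
  exact: measurable_center.
apply/seteqP; split => t /=.
  move=> Ut; have /nbhs_ballP[e /= e0 eU] : nbhs (decode t) U.
    by apply: open_nbhs_nbhs.
  (* Two points within [5 * rad m] of the center are within [10 * rad m] of each other. *)
  have [m me] := @rad_cvg0 (e / 10) ltac:(by rewrite divr_gt0).
  exists m => //; exists (center m t) => //= z cz.
  apply: eU; have /ball_sym/ball_triangle := decode_ball m t => /(_ _ _ cz).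
  by apply: le_ball; lra.
by move=> [m _ [i /= iU ci]]; apply: iU; rewrite -ci; exact: decode_ball.
Qed.

Lemma decode_preimage (U : set M) :
  <<s @open M >> U -> measurable (decode @^-1` U).
Proof.
suff : <<s @open M >> `<=` [set U | measurable (decode @^-1` U)] by exact.
apply: smallest_sub; last by move=> V oV; exact: decode_preimage_open.
split => [|V mV|F mF] /=.
- by rewrite preimage_set0.
- by rewrite setTD preimage_setC; exact: measurableC.
- by rewrite preimage_bigcup; exact: bigcupT_measurable.
Qed.

Definition encode (x : M) : R := tcode (fun k => x \in cell k).

Lemma hit_encode m i x : hit m i (encode x) = (x \in (ball (c i) (rad m) : set M)).
Proof. by rewrite /hit /encode tcodeK /cell pickleK. Qed.

(** At the code of a point the default is never taken: some [c i] lies within [rad m.+1] of [x],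
    hence within [rad m + rad m.+1 <= 2 * rad m] of the previous center. *)
Lemma center_encode m x : ball (c (center m (encode x))) (rad m) x.
Proof.
elim: m => [|m IH].
  have : hit 0 (center 0 (encode x)) (encode x).
    apply: (@first_indexP (hit 0 ^~ (encode x))); have [i xi] := cdense x (rad_gt0 0).
    by exists i; rewrite hit_encode inE.
  by rewrite hit_encode inE.
pose P i := hit m.+1 i (encode x) &&
  `[< ball (c (center m (encode x))) (2 * rad m) (c i) >].
have hP : exists i, P i.
  have [i xi] := cdense x (rad_gt0 m.+1).
  exists i; rewrite /P hit_encode mem_set//=; apply/asboolP.
  have := ball_triangle IH (ball_sym xi).
  by apply: le_ball; rewrite radS; have := rad_gt0 m.+1; lra.
have := first_indexP (center m (encode x)) hP.
by rewrite {1}/P hit_encode => /andP[]; rewrite inE.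
Qed.

Lemma encodeK : cancel encode decode.
Proof.
move=> x; apply/eqP; apply: contraT; rewrite -mdist_gt0 => /[dup] d0.
(* Both points lie near the [m]-th center, at distances below [5 * rad m] and [rad m], which gives
   the factor 6. *)
move=> d0'; have [m me] := @rad_cvg0 (mdist (decode (encode x)) x / 6)
  ltac:(by rewrite divr_gt0).
have := ball_triangle (ball_sym (decode_ball m (encode x))) (center_encode m x).
rewrite ballEmdist /=; lra.
Qed.

End borel_retract.

(* A standard Borel space is a Borel retract of the line, so that its
   conditional distributions can be constructed there: [f] records which
   balls around the points of a dense sequence contain [x], and [g] is the limit
   of a Cauchy sequence of centers read off from that record. *)
Lemma standard_borel_retract (R : realType) (d : measure_display)
    (T : measurableType d) :
  standard_borel R T -> exists (f : T -> R) (g : R -> T),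
    [/\ measurable_fun [set: T] f, measurable_fun [set: R] g,
        forall x, 0 <= f x & cancel f g].
Proof.
move=> [M [h [sM cM [h' hK h'K] mh]]].
have [c cdense] := separable_seq (h point) sM.
exists (encode c \o h), (h' \o decode c cM).
have mU k : measurable (h @^-1` cell c k).
  apply/mh; rewrite image_preimage.
    by apply: sub_sigma_algebra; exact: open_cell.
  by apply/seteqP; split => // y _; exists (h' y).
split.
- exact: (measurable_tcode mU).
- move=> _ A mA; rewrite setTI comp_preimage.
  have -> : h' @^-1` A = h @` A.
    apply/seteqP; split => [y Ay|y [x Ax <-]] /=; last by rewrite hK.
    by exists (h' y).
  by apply: decode_preimage; exact/mh.
- by move=> x; exact: tcode_ge0.
- by move=> x; rewrite /comp (encodeK cdense) hK.
Qed.

Local Open Scope ereal_scope.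

(** * Densities of nested sets *)

Lemma ex_measure (R : realType) d (T : measurableType d)
    (m : set T -> \bar R) :
  m set0 = 0 -> (forall A, 0 <= m A) ->
  (forall F, (forall i, measurable (F i)) -> trivIset [set: nat] F ->
    m (\bigcup_i F i) = \sum_(0 <= i <oo) m (F i)) ->
  exists mu : {measure set T -> \bar R}, mu = m :> (set T -> \bar R).
Proof.
move=> m0 m_ge0 mU.
have sm : semi_sigma_additive m.
  by move=> F mF tF _; rewrite mU//; exact: is_cvg_nneseries.
pose mm := isMeasure.Build d T R m m0 m_ge0 sm.
pose mu : {measure set T -> \bar R} := HB.pack m mm.
by exists mu.
Qed.

Lemma ex_spker (R : realType) d d' (X : measurableType d)
    (Y : measurableType d') (k : X -> {measure set Y -> \bar R}) :
  (forall A, measurable A -> measurable_fun [set: X] (k ^~ A)) ->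
  (forall x, k x setT <= 1) ->
  exists K : R.-spker X ~> Y, forall x A, K x A = k x A.
Proof.
move=> mk k1.
pose k' := k : X -> {measure set Y -> \bar R}.
have k1' : ereal_sup [set k' x [set: Y] | x in [set: X]] <= 1.
  exact: (sprob_kernelP (fun x => k' x : set Y -> \bar R)).2.
pose m1 := isKernel.Build d d' X Y R k' mk.
pose K1 : R.-ker X ~> Y := HB.pack k' m1.
pose m2 := Kernel_isSubProbability.Build d d' X Y R K1 k1'.
pose K : R.-spker X ~> Y := HB.pack (k' : X -> {measure set Y -> \bar R}) m1 m2.
by exists K.
Qed.

Lemma ex_integral_kernel (R : realType) d d' (Y : measurableType d)
    (Z : measurableType d') (nu : {measure set Y -> \bar R}) (B : set Y)
    (K : R.-ker Y ~> Z) :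
  measurable B ->
  exists m : {measure set Z -> \bar R},
    forall S, m S = \int[nu]_(y in B) K y S.
Proof.
move=> mB.
have [||F mF tF|m mE] := @ex_measure R _ Z (fun S => \int[nu]_(y in B) K y S).
- by apply: integral0_eq => y _; rewrite measure0.
- by move=> S; apply: integral_ge0.
- rewrite -integral_nneseries//; last first.
    by move=> n; apply: measurable_funTS; exact: measurable_kernel.
  apply: eq_integral => y _; apply: measure_semi_bigcup => //.
  exact: bigcupT_measurable.
- by exists m => S; rewrite mE.
Qed.

Lemma ex_rectangle_measurel (R : realType) d d' (X : measurableType d)
    (Y : measurableType d') (rho : {measure set (X * Y) -> \bar R}) (B : set Y) :
  measurable B ->
  exists m : {measure set X -> \bar R}, forall A, m A = rho (A `*` B).
Proof.
move=> mB.
have [||F mF tF|m mE] := @ex_measure R _ X (fun A => rho (A `*` B)).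
- by rewrite set0X measure0.
- by move=> A; apply: measure_ge0.
- rewrite setX_bigcupl; apply: measure_semi_bigcup => //.
  + by move=> i; exact: measurableX.
  + apply/trivIsetP => i j _ _ ij; rewrite -setXI.
    by move/trivIsetP : tF => ->//; rewrite set0X.
  + by apply: bigcupT_measurable => i; exact: measurableX.
- by exists m => A; rewrite mE.
Qed.

Lemma ex_rectangle_measurer (R : realType) d d' (X : measurableType d)
    (Y : measurableType d') (rho : {measure set (X * Y) -> \bar R}) (A : set X) :
  measurable A ->
  exists m : {measure set Y -> \bar R}, forall B, m B = rho (A `*` B).
Proof.
move=> mA.
have [||F mF tF|m mE] := @ex_measure R _ Y (fun B => rho (A `*` B)).
- by rewrite setX0 measure0.
- by move=> B; apply: measure_ge0.
- rewrite setX_bigcupr; apply: measure_semi_bigcup => //.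
  + by move=> i; exact: measurableX.
  + apply/trivIsetP => i j _ _ ij; rewrite -setXI.
    by move/trivIsetP : tF => ->//; rewrite setX0.
  + by apply: bigcupT_measurable => i; exact: measurableX.
- by exists m => B; rewrite mE.
Qed.

Section domination.
Context {R : realType} d {T : measurableType d} (nu : {measure set T -> \bar R}).
Implicit Types f g : T -> \bar R.

Lemma integralID (B E : set T) f : measurable B -> measurable E ->
  measurable_fun [set: T] f -> (forall y, 0 <= f y) ->
  \int[nu]_(y in B) f y =
  \int[nu]_(y in B `&` E) f y + \int[nu]_(y in B `\` E) f y.
Proof.
move=> mB mE mf f0; rewrite -[in LHS](setUIDK B E) ge0_integral_setU//.
- exact: measurableI.
- exact: measurableD.
- exact: measurable_funTS.
- by apply/disj_set2P; rewrite setDE setIACA setICr setI0.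
Qed.

Variables f g : T -> \bar R.
Hypotheses (mf : measurable_fun [set: T] f) (mg : measurable_fun [set: T] g).
Hypotheses (f0 : forall y, 0 <= f y) (g0 : forall y, 0 <= g y).
Hypothesis fg : forall B, measurable B ->
  \int[nu]_(y in B) f y <= \int[nu]_(y in B) g y.

Let E := [set y | g y < f y].

Let mE : measurable E.
Proof. by rewrite /E -[X in measurable X]setTI; exact: emeasurable_fun_lt. Qed.

(** On [E] the hypothesis [fg] gives one inequality and [g < f] the other. Nothing is subtracted, so
    infinite integrals are allowed. *)
Let integral_fgE B : measurable B ->
  \int[nu]_(y in B `&` E) f y = \int[nu]_(y in B `&` E) g y.
Proof.
move=> mB; have mBE : measurable (B `&` E) by exact: measurableI.
apply/eqP; rewrite eq_le fg//=; apply: ge0_le_integral => //.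
- exact: measurable_funTS.
- exact: measurable_funTS.
- by move=> y [_ /ltW].
Qed.

Lemma integral_maxe_dominated B : measurable B ->
  \int[nu]_(y in B) maxe (f y) (g y) = \int[nu]_(y in B) g y.
Proof.
move=> mB; rewrite (integralID mB mE)//; last 2 first.
- exact: measurable_maxe.
- by move=> y; rewrite le_max f0.
rewrite [RHS](integralID mB mE)// -integral_fgE//.
congr (_ + _); apply: eq_integral => y; rewrite inE => -[_].
- by move=> /ltW gf; apply/max_idPl.
- by move=> /negP; rewrite -leNgt => fgy; apply/max_idPr.
Qed.

Lemma integral_mine_dominated B : measurable B ->
  \int[nu]_(y in B) mine (f y) (g y) = \int[nu]_(y in B) f y.
Proof.
move=> mB; rewrite (integralID mB mE)//; last 2 first.
- exact: measurable_mine.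
- by move=> y; rewrite le_min f0 g0.
rewrite [RHS](integralID mB mE)// integral_fgE//.
congr (_ + _); apply: eq_integral => y; rewrite inE => -[_].
- by move=> /ltW gf; apply/min_idPr.
- by move=> /negP; rewrite -leNgt => fgy; apply/min_idPl.
Qed.

End domination.

(** The measure [lam] is cut into finite pieces along a disjoint exhaustion, each piece has a
    Radon-Nikodym derivative, and the derivatives are summed. *)
Lemma sigma_finite_density (R : realType) d (T : measurableType d)
    (nu : {sigma_finite_measure set T -> \bar R})
    (lam : {measure set T -> \bar R}) :
  (forall B, measurable B -> lam B <= nu B) ->
  exists phi : T -> \bar R, [/\ measurable_fun [set: T] phi,
    forall y, 0 <= phi y, forall y, phi y <= 1 &
    forall B, measurable B -> lam B = \int[nu]_(y in B) phi y].
Proof.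
move=> lamnu; have [F TF /all_and2[mF nuF]] := sigma_finiteT nu.
pose E := seqDU F.
have mE k : measurable (E k).
  by apply: measurableD => //; exact: bigsetU_measurable.
have lamE k : lam (E k) < +oo.
  rewrite (le_lt_trans (lamnu _ (mE k)))// (le_lt_trans _ (nuF k))//.
  by rewrite le_measure ?inE//; exact: subDsetl.
pose lam_ j : {finite_measure set T -> \bar R} := mfrestr (mE j) (lamE j).
have lam_nu k : lam_ k `<< nu.
  apply/null_content_dominatesP => S mS nuS0.
  apply/eqP; rewrite eq_le measure_ge0 andbT -nuS0 /= /mfrestr /mrestr.
  rewrite (le_trans (lamnu _ (measurableI _ _ mS (mE k))))//.
  by rewrite le_measure ?inE//; exact: measurableI.
have [g_] := choice (fun j => radon_nikodym_sigma_finite (lam_nu j)).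
move=> /all_and4[g_ge0 _ ig_ int_gE].
have mg_ k : measurable_fun [set: T] (g_ k) by have /integrableP[] := ig_ k.
pose g y := \sum_(0 <= j <oo) g_ j y.
have mg : measurable_fun [set: T] g by exact: ge0_emeasurable_sum.
have g0 y : 0 <= g y by exact: nneseries_ge0.
have gE B : measurable B -> lam B = \int[nu]_(y in B) g y.
  move=> mB; rewrite integral_nneseries//; last first.
    by move=> n; exact: measurable_funTS.
  transitivity (\sum_(0 <= j <oo) lam (B `&` E j)); last first.
    by apply: eq_eseriesr => j _; rewrite -int_gE.
  rewrite -measure_semi_bigcup//.
  - by rewrite -setI_bigcupr -seqDU_bigcup_eq -TF setIT.
  - by move=> i; exact: measurableI.
  - by apply: trivIset_setIl; exact: trivIset_seqDU.
  - by apply: bigcupT_measurable => i; exact: measurableI.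
(* Truncation gives the bound 1 at every point, which the quantile kernel needs, and keeps the
   integrals since [lam <= nu]. *)
exists (fun y => mine (g y) 1); split.
- exact: measurable_mine.
- by move=> y; rewrite le_min g0 lee01.
- by move=> y; rewrite ge_min lexx orbT.
- move=> B mB; rewrite integral_mine_dominated//; first exact: gE.
  by move=> C mC; rewrite -gE// integral_cst// mul1e; exact: lamnu.
Qed.

Lemma bigcup_bigsetU_ord (T : Type) (F : nat -> set T) :
  \bigcup_N \big[setU/set0]_(n < N) F n = \bigcup_n F n.
Proof.
apply/seteqP; split => x [n _].
  by rewrite -bigcup_mkord => -[k _ Fk]; exists k.
by move=> Fn; exists n.+1 => //; rewrite -bigcup_mkord; exists n => /=.
Qed.

Lemma le_bigsetU_ord (T : Type) (F : nat -> set T) m n : (m <= n)%N ->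
  \big[setU/set0]_(i < m) F i `<=` \big[setU/set0]_(i < n) F i.
Proof.
move=> mn; rewrite -!bigcup_mkord => x [i /= im Fi].
by exists i => //=; exact: leq_trans mn.
Qed.

(** The interval from 0 to [a], of length [a] when [0 <= a]. The level of a maximum is the union of
    the levels, so suprema of densities become lengths of unions. *)
Definition level (R : realType) (a : \bar R) : set (measurableTypeR R) :=
  [set u | (0 <= u)%R /\ u%:E < a].

Lemma levelE (R : realType) (a : \bar R) : level a =
  match a with r%:E => `[0%R, r[%classic | +oo => `[0%R, +oo[%classic
  | -oo => set0 end.
Proof.
rewrite /level; case: a => [a| |]; apply/seteqP; split => u /=.
- by rewrite in_itv/= lte_fin => -[-> ->].
- by rewrite in_itv/= lte_fin => /andP.
- by rewrite in_itv/= => -[->].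
- by rewrite in_itv/= andbT ltry.
- by rewrite ltNge leNye => -[].
- by [].
Qed.

Lemma level0 (R : realType) : level (0 : \bar R) = set0.
Proof. by apply/seteqP; split => u //= -[u0]; rewrite lte_fin ltNge u0. Qed.

Lemma measurable_level (R : realType) (a : \bar R) : measurable (level a).
Proof. by rewrite levelE; case: a => [a| |]; [exact: measurable_itv..|]. Qed.

Lemma lebesgue_level (R : realType) (a : \bar R) : 0 <= a -> lebesgue_measure (level a) = a.
Proof.
rewrite levelE; case: a => [a| |]//.
  rewrite lee_fin => a0; rewrite lebesgue_measure_itv/= lte_fin oppr0 adde0.
  by case: ltP => // ha; congr EFin; apply/eqP; rewrite eq_le a0.
by rewrite lebesgue_measure_itv/= ltry oppr0 adde0.
Qed.

Section chain_density.
Context {R : realType} d d' {X : measurableType d} {Y : measurableType d'}.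
Variables (rho : {measure set (X * Y) -> \bar R}) (nu : {measure set Y -> \bar R}).
Variables (A : nat -> set X) (phi : nat -> Y -> \bar R).
Hypotheses (mA : forall n, measurable (A n))
  (chainA : forall m n, A m `<=` A n \/ A n `<=` A m)
  (mphi : forall n, measurable_fun [set: Y] (phi n))
  (phi0 : forall n y, 0 <= phi n y)
  (phiE : forall n B, measurable B ->
    rho (A n `*` B) = \int[nu]_(y in B) phi n y).

Let U N := \big[setU/set0]_(n < N) A n.
Let M N y := iteri N (fun n a => maxe a (phi n y)) 0.

Let mU N : measurable (U N). Proof. exact: bigsetU_measurable. Qed.

Let mM N : measurable_fun [set: Y] (M N).
Proof.
by elim: N => [|N IH]; [exact: measurable_cst|exact: measurable_maxe].
Qed.

Let M0 N y : 0 <= M N y.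
Proof. by elim: N => // N IH; rewrite /M /= le_max IH. Qed.

Let nondecreasing_M y : {homo M ^~ y : m n / (m <= n)%N >-> m <= n}.
Proof.
apply/nondecreasing_seqP => n.
by rewrite /M /= le_max lexx.
Qed.

(** Either an earlier member already contains [A N], or, by [chainA], every earlier member is
    contained in it. *)
Let chainU N : U N `<=` A N \/ A N `<=` U N.
Proof.
have [h|h] := pselect (exists2 n, (n < N)%N & A N `<=` A n).
  right; have [n nN An] := h; apply: (subset_trans An).
  by rewrite /U -bigcup_mkord => x Anx; exists n.
left; rewrite /U -bigcup_mkord => x [n /= nN Anx].
by have [|An] := chainA n N; [exact|case: h; exists n].
Qed.

Let finite_chain_density N B : measurable B ->
  rho (U N `*` B) = \int[nu]_(y in B) M N y.
Proof.
elim: N B => [|N IH] B mB.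
  by rewrite /U big_ord0 set0X measure0; apply/esym/integral0_eq.
rewrite /U big_ord_recr/= -/(U N).
have le_rho (C D : set X) E : measurable C -> measurable D -> measurable E ->
    C `<=` D -> rho (C `*` E) <= rho (D `*` E).
  move=> mC mD mE CD; apply: le_measure; rewrite ?inE; try exact: measurableX.
  exact: setSX.
change (M N.+1) with (fun y => maxe (M N y) (phi N y)).
(* Of two nested sets the smaller has the smaller [rho]-mass over every [C], so the integrals of its
   density are dominated; the maximum then integrates like the density of the larger set. *)
case: (chainU N) => [UA|AU].
  rewrite ((setUidPr _ _).2 UA) integral_maxe_dominated ?phiE// => C mC.
  by rewrite -IH// -phiE//; exact: le_rho.
rewrite ((setUidPl _ _).2 AU).
under eq_integral do rewrite maxC.
rewrite integral_maxe_dominated// ?IH// => C mC.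
by rewrite -IH// -phiE//; exact: le_rho.
Qed.

Let level_bigmaxe N y :
  level (M N y) = \big[setU/set0]_(n < N) level (phi n y).
Proof.
elim: N => [|N IH].
  by rewrite big_ord0 level0.
rewrite big_ord_recr/= -IH; apply/seteqP; split => u /=.
  by move=> [u0]; rewrite /M /= lt_max => /orP[]; [left|right].
by move=> [[u0 h]|[u0 h]]; split => //; rewrite /M /= lt_max h// orbT.
Qed.

(* The length of the union is the sup of the densities; it is written in the form
   under which it shows up as a value of the quantile kernel. *)
Lemma chain_density B : measurable B ->
  rho ((\bigcup_n A n) `*` B) =
  \int[nu]_(y in B) lebesgue_measure (\bigcup_n level (phi n y)).
Proof.
move=> mB.
have limM y : lebesgue_measure (\bigcup_n level (phi n y)) = limn (M ^~ y).
  apply/esym/cvg_lim => //.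
  have := @nondecreasing_cvg_mu _ _ _ (@lebesgue_measure R)
    (fun N => \big[setU/set0]_(n < N) level (phi n y)).
  rewrite (bigcup_bigsetU_ord (fun n => level (phi n y))).
  have -> : lebesgue_measure \o (fun N => \big[setU/set0]_(n < N) level (phi n y))
      = M ^~ y.
    by apply/funext => N /=; rewrite -level_bigmaxe lebesgue_level.
  apply.
  - by move=> N; apply: bigsetU_measurable => n _; exact: measurable_level.
  - by apply: bigcupT_measurable => n; exact: measurable_level.
  - move=> m n mn; apply/subsetPset.
    exact: (le_bigsetU_ord (F := fun n => level (phi n y))).
under eq_integral do rewrite limM.
(* Both sides are limits of the identity for finite unions, by monotone convergence on one side and
   continuity of [rho] from below on the other. *)
have h1 : \int[nu]_(y in B) M N y @[N --> \oo] -->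
    \int[nu]_(y in B) limn (M ^~ y).
  apply: cvg_monotone_convergence => //.
  by move=> n; exact: measurable_funTS.
rewrite -(cvg_lim _ h1)//; apply/esym/cvg_lim => //.
under eq_fun do rewrite -finite_chain_density//.
have -> : (\bigcup_n A n) `*` B = \bigcup_n (U n `*` B).
  by rewrite -setX_bigcupl bigcup_bigsetU_ord.
apply: nondecreasing_cvg_mu.
- by move=> n; exact: measurableX.
- by apply: bigcupT_measurable => n; exact: measurableX.
- move=> m n mn; apply/subsetPset; apply: setSX => //; exact: le_bigsetU_ord.
Qed.

End chain_density.

(** * The quantile kernel and disintegration *)

(** A ray with real end point is the union of the rays with smaller rational end points. *)
Lemma measurable_rat_raysE (R : realType) :
  @measurable _ (measurableTypeR R) =
  <<s [set A | exists q : rat, A = `]-oo, (ratr q : R)[%classic] >>.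
Proof.
rewrite [LHS]RGenInftyO.measurableE; apply/seteqP; split => A; last first.
  apply: smallest_sub; first exact: smallest_sigma_algebra.
  by move=> _ [q ->]; apply: sub_sigma_algebra; exists (ratr q).
apply: smallest_sub; first exact: smallest_sigma_algebra.
move=> _ [x ->].
set G := [set _ | _]; have [s0 _ sU] := smallest_sigma_algebra setT G.
pose F n := if (unpickle n : option rat) is Some q then
  if (ratr q < x)%R then `]-oo, (ratr q : R)[%classic else set0 else set0.
rewrite (_ : `]-oo, x[%classic = \bigcup_n F n).
  apply: sU => n; rewrite /F; case: unpickle => // q; case: ifP => // _.
  by apply: sub_sigma_algebra; exists q.
apply/seteqP; split => [y|y [n _]]; rewrite /= in_itv/=.
  move=> yx; have [q] := rat_in_itvoo yx; rewrite in_itv/= => /andP[yq qx].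
  have Fq : F (pickle q) = `]-oo, ratr q[%classic by rewrite /F pickleK qx.
  exists (pickle q); first exact: I.
  by rewrite Fq; rewrite /= in_itv.
rewrite /F; case: unpickle => // q; case: ifP => // qx.
by rewrite /= in_itv/= => /lt_trans; apply.
Qed.

Lemma measure_eq_rat_rays (R : realType)
    (m1 m2 : {measure set (measurableTypeR R) -> \bar R}) :
  (forall q : rat, m1 `]-oo, ratr q[%classic = m2 `]-oo, ratr q[%classic) ->
  m1 setT < +oo -> forall S, measurable S -> m1 S = m2 S.
Proof.
move=> m12 m1oo.
pose g n : set (measurableTypeR R) := `]-oo, (n%:R : R)[%classic.
apply: (measure_unique _ g (measurable_rat_raysE R)).
- move=> _ _ [p ->] [q ->]; exists (Order.min p q).
  apply/seteqP; split => x; rewrite /= !in_itv/= minEle.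
    by move=> [xp xq]; case: ifP.
  case: ifPn => [pq xm|]; last rewrite -ltNge => /ltW pq xm.
    by split => //; apply: (lt_le_trans xm); rewrite ler_rat.
  by split => //; apply: (lt_le_trans xm); rewrite ler_rat.
- by move=> n; exists n%:R; rewrite /g ratr_nat.
- apply/seteqP; split => // x _; exists (Num.truncn `|x|).+1 => //.
  rewrite /g /= in_itv/= (le_lt_trans (ler_norm x))//.
  by have /truncn_itv/andP[] : (0 <= `|x|)%R by [].
- by move=> _ [q ->]; exact: m12.
- move=> n; rewrite (le_lt_trans _ m1oo)//; apply: le_measure => //; rewrite inE.
    exact: measurable_itv.
  exact: measurableT.
Qed.

(** Sets of finite [nu]-measure are stable under intersection and generate, since each set is the
    union of its traces on an exhaustion. This lifts the finiteness restriction on [B] in the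
    disintegration. *)
Lemma measure_eq_finite_sets (R : realType) d (T : measurableType d)
    (nu : {sigma_finite_measure set T -> \bar R})
    (m1 m2 : {measure set T -> \bar R}) :
  (forall B, measurable B -> m1 B <= nu B) ->
  (forall B, measurable B -> nu B < +oo -> m1 B = m2 B) ->
  forall B, measurable B -> m1 B = m2 B.
Proof.
move=> m1nu m12; have [F TF mnF] := sigma_finiteT nu.
pose G := [set B | measurable B /\ nu B < +oo].
apply: (@measure_unique _ _ _ G F).
- apply/seteqP; split => A; last first.
    apply: smallest_sub; first exact: sigma_algebra_measurable.
    by move=> ? [].
  move=> mA.
  have -> : A = \bigcup_i (A `&` F i) by rewrite -setI_bigcupr -TF setIT.
  have [_ _ sU] := smallest_sigma_algebra setT G; apply: sU => n.
  apply: sub_sigma_algebra; have [mF nuF] := mnF n; split.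
    exact: measurableI.
  rewrite (le_lt_trans _ nuF)// le_measure ?inE//; exact: measurableI.
- move=> A B [mA nuA] [mB nuB]; split; first exact: measurableI.
  by rewrite (le_lt_trans _ nuA)// le_measure ?inE//; exact: measurableI.
- by move=> i; exact: mnF.
- by [].
- by move=> A [mA nuA]; exact: m12.
- by move=> k; have [mF nuF] := mnF k; rewrite (le_lt_trans (m1nu _ mF)).
Qed.

(** * Kernels from sections and quantiles *)

Section section_kernel.
Context {R : realType} d d' {Y : measurableType d} {Z : measurableType d'}.
Variables (D : set (Y * measurableTypeR R)) (G : Y * measurableTypeR R -> Z).
Hypotheses (mD : measurable D) (mG : measurable_fun D G)
  (D1 : forall y, lebesgue_measure (xsection D y) <= 1).

(** The kernel at [y] is the image under [G (y, _)] of Lebesgue measure on the section of [D]; its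
    measurability in [y] is that of the lengths of sections. *)
Lemma section_kernel : exists K : R.-spker Y ~> Z, forall y S,
  K y S = lebesgue_measure (xsection (D `&` G @^-1` S) y).
Proof.
have mDG S : measurable S -> measurable (D `&` G @^-1` S) by exact: mG.
have hk y : exists m : {measure set Z -> \bar R}, forall S,
    m S = lebesgue_measure (xsection (D `&` G @^-1` S) y).
  have [||F mF tF|m mE] := @ex_measure R _ Z (fun S =>
    lebesgue_measure (xsection (D `&` G @^-1` S) y)).
  - by rewrite preimage_set0 setI0 xsection0 measure0.
  - by move=> S; exact: measure_ge0.
  - rewrite preimage_bigcup setI_bigcupr xsection_bigcup.
    apply: measure_semi_bigcup => //.
    + by move=> i; apply: measurable_xsection; exact: mDG.
    + apply: trivIset_xsection; apply: trivIset_setIl.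
      apply/trivIsetP => i j _ _ ij; rewrite -preimage_setI.
      by move/trivIsetP : tF => ->//; rewrite preimage_set0.
    + apply: bigcupT_measurable => i; apply: measurable_xsection; exact: mDG.
  - by exists m => S; rewrite mE.
have [k kE] := choice hk.
have [A mA|y|K KE] := @ex_spker R _ _ Y Z k.
- rewrite (_ : k ^~ A = lebesgue_measure \o xsection (D `&` G @^-1` A)).
    by apply: measurable_fun_xsection; exact: mDG.
  by apply/funext => y /=; rewrite kE.
- by rewrite kE preimage_setT setIT.
- by exists K => y S; rewrite KE kE.
Qed.

End section_kernel.

Section quantile_kernel.
Context {R : realType} d {Y : measurableType d}.
Variables (q : nat -> R) (phi : nat -> Y -> \bar R).
Hypotheses (q0 : forall n, (0 <= q n)%R)
  (mphi : forall n, measurable_fun [set: Y] (phi n))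
  (phi1 : forall n y, phi n y <= 1).

Let L n : set (Y * measurableTypeR R) := [set yu | level (phi n yu.1) yu.2].

Let mL n : measurable (L n).
Proof.
rewrite (_ : L n = [set yu | (cst 0 yu <= yu.2)%R] `&`
    [set yu : Y * measurableTypeR R | yu.2%:E < phi n yu.1]); last by [].
apply: measurableI.
  by rewrite -[X in measurable X]setTI; apply: measurable_fun_le.
rewrite -[X in measurable X]setTI; apply: emeasurable_fun_lt => //.
  by apply/measurable_EFinP.
exact: measurableT_comp (mphi n) measurable_fst.
Qed.

(** On [D] the set under the infimum defining [G] is nonempty, which keeps the default value of
    [inf] out. *)
Let D := \bigcup_n L n.

Let G (yu : Y * measurableTypeR R) : measurableTypeR R :=
  inf [set q n | n in [set n | L n yu]].

(** An infimum is below [t] exactly when one of its terms is; [q0] supplies the lower bound. *)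
Let G_lt t : D `&` G @^-1` `]-oo, t[ = \bigcup_(n in [set n | (q n < t)%R]) L n.
Proof.
apply/seteqP; split => yu /=.
  rewrite in_itv/= => -[[n _ Ln]] /inf_lt[|_ [m Lm <-] qt].
    by exists (q n); exists n.
  by exists m.
move=> [n /= qt Ln]; split; first by exists n.
rewrite in_itv/=; apply: le_lt_trans qt; apply: ge_inf.
  by exists 0%R => _ [m _ <-].
by exists n.
Qed.

(* [G (y, _)] is the quantile function of [q n |-> phi n y]; no monotonicity or
   continuity of the latter is needed. *)
Lemma quantile_kernel : exists K : R.-spker Y ~> measurableTypeR R, forall y t,
  K y `]-oo, t[%classic = lebesgue_measure
    (\bigcup_n level (if (q n < t)%R then phi n y else 0)).
Proof.
have mD : measurable D by exact: bigcupT_measurable.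
have mG : measurable_fun D G.
  apply: (measurability _ (RGenInftyO.measurableE R)) => _ [_ [t ->] <-].
  by rewrite G_lt; apply: bigcup_measurable.
have sectionL n y : xsection (L n) y = level (phi n y).
  by rewrite xsectionE.
have D1 y : lebesgue_measure (xsection D y) <= 1.
  rewrite /D xsection_bigcup -[leRHS](@lebesgue_level R)//.
  apply: le_measure; rewrite ?inE; last first.
  - by move=> u [n _]; rewrite sectionL => -[u0 /lt_le_trans]; split => //; auto.
  - exact: measurable_level.
  - by apply: bigcupT_measurable => n; exact: measurable_xsection.
have [K KE] := section_kernel mD mG D1.
exists K => y t; rewrite KE G_lt; congr lebesgue_measure.
(* Indices with [t <= q n] are kept with the level of 0, which is empty; the union then runs over
   all [n], as in [chain_density]. *)
rewrite bigcup_mkcond xsection_bigcup; apply: eq_bigcup => // n _.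
rewrite fun_if; case: ifPn => qt; first by rewrite ifT ?sectionL// -inE.
rewrite ifF ?xsection0 ?level0//.
by apply/negbTE; apply: contra qt; rewrite inE.
Qed.

End quantile_kernel.

Lemma ex_pushforward (R : realType) d d' (X : measurableType d)
    (Y : measurableType d') (m : {measure set X -> \bar R}) (f : X -> Y) :
  measurable_fun [set: X] f ->
  exists m' : {measure set Y -> \bar R}, forall A, m' A = m (f @^-1` A).
Proof.
move=> mf.
have mfA A : measurable A -> measurable (f @^-1` A).
  by move=> mA; rewrite -[X in measurable X]setTI; exact: mf.
have [||F mF tF|m' m'E] := @ex_measure R _ Y (fun A => m (f @^-1` A)).
- by rewrite preimage_set0 measure0.
- by move=> A; exact: measure_ge0.
- rewrite preimage_bigcup measure_semi_bigcup//.
  + by move=> i; exact: mfA.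
  + apply/trivIsetP => i j _ _ ij; rewrite -preimage_setI.
    by move/trivIsetP : tF => ->//; rewrite preimage_set0.
  + by apply: bigcupT_measurable => i; exact: mfA.
- by exists m' => A; rewrite m'E.
Qed.

Lemma dense_nneg_seq (R : realType) : exists q : nat -> R,
  (forall n, (0 <= q n)%R) /\
  forall x t : R, (0 <= x)%R -> (x < t)%R -> exists n, (x < q n < t)%R.
Proof.
exists (fun n => `|ratr (odflt 0%R (unpickle n : option rat))|%R); split => //.
move=> x t x0 xt; have [p] := rat_in_itvoo xt; rewrite in_itv/= => xpt.
by exists (pickle p); rewrite pickleK/= ger0_norm//; move/andP: xpt; lra.
Qed.

(** * Disintegration along the second marginal *)

Section disintegration.
Context {R : realType} d d' {X : measurableType d} {Y : measurableType d'}.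
Variables (rho : {measure set (X * Y) -> \bar R})
  (nu : {sigma_finite_measure set Y -> \bar R}).
Hypothesis rho_snd : forall B, measurable B -> rho (setT `*` B) = nu B.

Let rho_le_nu A B : measurable A -> measurable B -> rho (A `*` B) <= nu B.
Proof.
move=> mA mB; rewrite -rho_snd//; apply: le_measure; rewrite ?inE.
- exact: measurableX.
- exact: measurableX.
- exact: setSX.
Qed.

Lemma disintegration_fun (f : X -> R) :
  measurable_fun [set: X] f -> (forall x, (0 <= f x)%R) ->
  exists K : R.-spker Y ~> measurableTypeR R, forall S B,
    measurable S -> measurable B ->
    rho ((f @^-1` S) `*` B) = \int[nu]_(y in B) K y S.
Proof.
move=> mf f0; have [q [q0 qdense]] := dense_nneg_seq R.
have mfS (S : set (measurableTypeR R)) : measurable S -> measurable (f @^-1` S).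
  by move=> mS; rewrite -[X in measurable X]setTI; exact: mf.
have mray (t : R) : measurable (f @^-1` `]-oo, t[) by apply: mfS; exact: measurable_itv.
pose A n := f @^-1` `]-oo, q n[.
have /choice[phi /all_and4[mphi phi0 phi1 phiE]] n :
    exists phi : Y -> \bar R, [/\ measurable_fun [set: Y] phi,
      forall y, 0 <= phi y, forall y, phi y <= 1 &
      forall B, measurable B -> rho (A n `*` B) = \int[nu]_(y in B) phi y].
  have [lam lamE] := ex_rectangle_measurer rho (mray (q n)).
  have [|phi [? ? ? phiE]] := @sigma_finite_density R _ Y nu lam.
    by move=> B mB; rewrite lamE; exact: rho_le_nu.
  by exists phi; split => // B mB; rewrite -phiE.
have [K KE] := quantile_kernel q0 mphi phi1.
exists K.
have rayE t B : measurable B ->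
    rho ((f @^-1` `]-oo, t[) `*` B) = \int[nu]_(y in B) K y `]-oo, t[%classic.
  (* Indices with [t <= q n] get the empty set, with density 0; by [f0] some nonnegative [q n] lies
     between [f x] and [t]. *)
  move=> mB; pose A' n := if (q n < t)%R then A n else set0.
  have -> : f @^-1` `]-oo, t[ = \bigcup_n A' n.
    apply/seteqP; split => [x|x [n _]]; rewrite /= in_itv/=.
      move=> /(qdense _ _ (f0 x))[n /andP[fq qt]]; exists n => //.
      by rewrite /A' qt /A /= in_itv.
    rewrite /A'; case: ifP => // qt; rewrite /A /= in_itv/= => /lt_trans; exact.
  under eq_integral do rewrite KE.
  apply: (@chain_density _ _ _ _ _ rho nu A'
    (fun n y => if (q n < t)%R then phi n y else 0)) => //.
  - by move=> n; rewrite /A'; case: ifP => // _; exact: mray.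
  - move=> m n; rewrite /A'; case: ifP => _; last by left.
    case: ifP => _; last by right.
    have [mn|/ltW nm] := leP (q m) (q n); [left|right] => x;
      rewrite /A /= !in_itv/= => fx; exact: lt_le_trans fx _.
  - by move=> n; case: (q n < t)%R; [exact: mphi|exact: measurable_cst].
  - by move=> n y; case: ifP.
  - move=> n C mC; rewrite /A'; case: ifP => _; first exact: phiE.
    by rewrite set0X measure0 integral0.
(* For fixed [B] both sides are finite measures in [S] that agree on rational rays. *)
have finE S B : measurable S -> measurable B -> nu B < +oo ->
    rho ((f @^-1` S) `*` B) = \int[nu]_(y in B) K y S.
  move=> mS mB nuB.
  have [m1 m1E] := @ex_integral_kernel R _ _ Y _ nu B K mB.
  have [m2 m2E] := ex_rectangle_measurel rho mB.
  have [m3 m3E] := @ex_pushforward R _ _ X (measurableTypeR R) m2 f mf.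
  rewrite -m1E -m2E -m3E; apply: measure_eq_rat_rays => //.
  - by move=> p; rewrite m3E m2E m1E rayE.
  - by rewrite m3E m2E preimage_setT rho_snd.
(* For fixed [S] both sides are measures in [B], equal on sets of finite [nu]-measure. *)
move=> S B mS; move: B.
have [m2 m2E] := ex_rectangle_measurer rho (mfS _ mS).
have mKS : measurable_fun [set: Y] (K ^~ S) by exact: measurable_kernel.
have [||F mF tF|m1 m1E] := @ex_measure R _ Y (fun B => \int[nu]_(y in B) K y S).
- by rewrite integral_set0.
- by move=> B; apply: integral_ge0.
- by rewrite ge0_integral_bigcup//; exact: measurable_funTS.
have {}m1E B : m1 B = \int[nu]_(y in B) K y S by rewrite m1E.
move=> B mB; rewrite -m2E -m1E.
apply: (@measure_eq_finite_sets R _ _ nu) => // C mC.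
- by rewrite m2E; apply: rho_le_nu => //; exact: mfS.
- by move=> nuC; rewrite m2E m1E; exact: finE.
Qed.

(** The kernel on the line is carried to [X] by [g]; since [g] undoes [f], pulling [A] back by [g]
    and then by [f] returns [A]. *)
Lemma disintegration : standard_borel R X ->
  exists Q : R.-spker Y ~> X, forall A B, measurable A -> measurable B ->
    rho (A `*` B) = \int[nu]_(y in B) Q y A.
Proof.
move=> /standard_borel_retract[f [g [mf mg f0 fK]]].
have [K KE] := disintegration_fun mf f0.
have mgA A : measurable A -> measurable (g @^-1` A : set (measurableTypeR R)).
  by move=> mA; rewrite -[X in measurable X]setTI; exact: mg.
have [k kE] := choice (fun y => @ex_pushforward R _ _ (measurableTypeR R) X (K y) g mg).
have [A mA|y|Q QE] := @ex_spker R _ _ Y X k.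
- under eq_fun do rewrite kE; apply: measurable_kernel; exact: mgA.
- by rewrite kE preimage_setT sprob_kernel_le1.
- exists Q => A B mA mB; under eq_integral do rewrite QE kE.
  rewrite -KE//; last exact: mgA.
  by congr (rho (_ `*` _)); apply/seteqP; split => x /=; rewrite fK.
Qed.

End disintegration.

(** * Uniqueness *)

Section sigma_finite_bundle.
Context {R : realType} d {T : measurableType d} (m : {measure set T -> \bar R}).

(** A copy of [m] that carries the proof [sm], so that the sigma-finite structure can be attached to
    it. *)
Definition sigma_finite_bundle (sm : sigma_finite [set: T] m) :
  set T -> \bar R := m.

Variable sm : sigma_finite [set: T] m.

HB.instance Definition _ := Measure.on (sigma_finite_bundle sm).

HB.instance Definition _ :=
  Measure_isSigmaFinite.Build d T R (sigma_finite_bundle sm) sm.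

Lemma ex_sigma_finite_measure :
  exists mu : {sigma_finite_measure set T -> \bar R},
    mu = m :> (set T -> \bar R).
Proof. by exists (sigma_finite_bundle sm). Qed.

End sigma_finite_bundle.

(** * Semidirect product of a measure and a kernel *)

Section semidirect_product.
Context {R : realType} d d' {X : measurableType d} {Y : measurableType d'}.
Variables (nu : {measure set X -> \bar R}) (P : R.-fker X ~> Y).

Lemma ex_semidirect_product : exists rho : {measure set (X * Y) -> \bar R},
  forall A B, measurable A -> measurable B ->
    rho (A `*` B) = \int[nu]_(x in A) P x B.
Proof.
have [||F mF tF|rho rhoE] := @ex_measure R _ (X * Y)%type
  (fun C => \int[nu]_x P x (xsection C x)).
- by apply: integral0_eq => x _; rewrite xsection0 measure0.
- by move=> C; exact: integral_ge0.
- rewrite -integral_nneseries//; last first.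
    by move=> n; apply: measurable_fun_xsection_finite_kernel; rewrite inE.
  apply: eq_integral => x _; rewrite xsection_bigcup measure_semi_bigcup//.
  + by move=> i; exact: measurable_xsection.
  + exact: trivIset_xsection.
  + by apply: bigcupT_measurable => i; exact: measurable_xsection.
- exists rho => A B mA mB; rewrite rhoE [RHS]integral_mkcond.
  apply: eq_integral => x _; rewrite patchE; case: ifPn => xA.
    by rewrite in_xsectionX.
  by rewrite notin_xsectionX// measure0.
Qed.

End semidirect_product.

(** Rectangles are stable under intersection and generate the product; strips over an exhaustion of
    [Y] by sets of finite [nu]-measure have finite [m1]-mass. *)
Lemma measure_eq_rectangles (R : realType) d d' (X : measurableType d)
    (Y : measurableType d') (m1 m2 : {measure set (X * Y) -> \bar R})
    (nu : {sigma_finite_measure set Y -> \bar R}) :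
  (forall B, measurable B -> m1 (setT `*` B) = nu B) ->
  (forall A B, measurable A -> measurable B -> m1 (A `*` B) = m2 (A `*` B)) ->
  forall C, measurable C -> m1 C = m2 C.
Proof.
move=> m1nu m12; have [F TF mnF] := sigma_finiteT nu.
apply: (measure_unique _ (fun n => setT `*` F n)
  (measurable_prod_measurableType X Y)).
- move=> _ _ [A mA [B mB <-]] [A' mA' [B' mB' <-]]; rewrite -setXI.
  exists (A `&` A'); first exact: measurableI.
  by exists (B `&` B') => //; exact: measurableI.
- by move=> n; exists setT => //; exists (F n) => //; case: (mnF n).
- by rewrite -setX_bigcupr -TF setXTT.
- by move=> _ [A mA [B mB <-]]; exact: m12.
- by move=> n; have [mF nuF] := mnF n; rewrite m1nu.
Qed.

(** The bound [h <= 1] makes [h] integrable on each set of a finite-measure exhaustion, where equal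
    integrals force almost everywhere equality; the countably many null sets are united. *)
Lemma ae_eq_integral_sets (R : realType) d (T : measurableType d)
    (nu : {sigma_finite_measure set T -> \bar R}) (h k : T -> \bar R) :
  measurable_fun [set: T] h -> measurable_fun [set: T] k ->
  (forall y, 0 <= h y) -> (forall y, h y <= 1) ->
  (forall B, measurable B -> \int[nu]_(y in B) h y = \int[nu]_(y in B) k y) ->
  {ae nu, forall y, h y = k y}.
Proof.
move=> mh mk h0 h1 hk; have [F TF mnF] := sigma_finiteT nu.
have aeF n : {ae nu, forall y, F n y -> h y = k y}.
  have [mF nuF] := mnF n.
  apply: integral_ae_eq => //.
  - apply/integrableP; split; first exact: measurable_funTS.
    under eq_integral do rewrite gee0_abs//.
    apply: le_lt_trans nuF; rewrite -[leRHS]mul1e -integral_cst//.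
    by apply: ge0_le_integral => //; exact: measurable_funTS.
  - exact: measurable_funTS.
  - by move=> E EF mE; exact: hk.
apply: filterS (ae_foralln aeF) => y hy.
by have [n _ Fy] : (\bigcup_n F n) y; [rewrite -TF|exact: hy Fy].
Qed.

(* Since [f] is a Borel injection into the line, a finite measure is determined
   by the countably many values [m (f @^-1` `]-oo, q[)], [q] rational: the
   exceptional null sets of the uniqueness proof can be united. *)
Lemma kernel_ae_unique (R : realType) d d' (X : measurableType d)
    (Y : measurableType d') (nu : {sigma_finite_measure set Y -> \bar R})
    (Q Q' : R.-spker Y ~> X) :
  standard_borel R X ->
  (forall A B, measurable A -> measurable B ->
    \int[nu]_(y in B) Q' y A = \int[nu]_(y in B) Q y A) ->
  {ae nu, forall y, forall A, measurable A -> Q' y A = Q y A}.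
Proof.
move=> /standard_borel_retract[f [g [mf mg f0 fK]]] QQ'.
have mfS (S : set (measurableTypeR R)) : measurable S -> measurable (f @^-1` S).
  by move=> mS; rewrite -[X in measurable X]setTI; exact: mf.
pose ray n := f @^-1` `]-oo, (ratr (odflt 0%R (unpickle n : option rat)) : R)[.
have mray n : measurable (ray n) by apply: mfS; exact: measurable_itv.
have : {ae nu, forall y, forall n, Q' y (ray n) = Q y (ray n)}.
  apply: ae_foralln => n; apply: ae_eq_integral_sets.
  - exact: measurable_kernel.
  - exact: measurable_kernel.
  - by [].
  - move=> y; apply: le_trans (sprob_kernel_le1 Q' y).
    by apply: le_measure; rewrite ?inE.
  - by move=> B mB; exact: QQ'.
apply: filterS => y Qray A mA.
have [m mE] := @ex_pushforward R _ _ X (measurableTypeR R) (Q y) f mf.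
have [m' m'E] := @ex_pushforward R _ _ X (measurableTypeR R) (Q' y) f mf.
have -> : A = f @^-1` (g @^-1` A).
  by apply/seteqP; split => x /=; rewrite fK.
rewrite -mE -m'E; apply: measure_eq_rat_rays.
- by move=> q; rewrite mE m'E; have := Qray (pickle q); rewrite /ray pickleK.
- rewrite m'E preimage_setT (le_lt_trans (sprob_kernel_le1 Q' y))//.
  exact: ltry.
- by rewrite -[X in measurable X]setTI; exact: mg.
Qed.

(** [hnu1P] expresses that the second marginal is sigma-finite, as [nu2] has to be the image of
    [nu1] under [P]. The type of [Q] encodes values in [0,1]; the disintegration makes [Q y] a
    probability for [nu2]-almost every [y]. *)
Theorem theorem5p16 (R : realType) (d1 d2 : measure_display)
    (X1 : measurableType d1) (X2 : measurableType d2)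
    (hX1 : standard_borel R X1) (hX2 : standard_borel R X2)
    (P : R.-pker X1 ~> X2)
    (nu1 : {sigma_finite_measure set X1 -> \bar R})
    (hnu1P : sigma_finite [set: X2] (kernel_act nu1 P)) :
  exists (rho : {sigma_finite_measure set (X1 * X2)%type -> \bar R})
         (nu2 : {sigma_finite_measure set X2 -> \bar R})
         (Q : R.-spker X2 ~> X1),
    dual_system nu1 P rho nu2 Q /\
    forall (rho' : {sigma_finite_measure set (X1 * X2)%type -> \bar R})
           (nu2' : {sigma_finite_measure set X2 -> \bar R})
           (Q' : R.-spker X2 ~> X1),
      dual_system nu1 P rho' nu2' Q' ->
      [/\ forall C : set (X1 * X2)%type, measurable C -> rho' C = rho C,
          forall B : set X2, measurable B -> nu2' B = nu2 B &
          {ae nu2, forall y, forall A : set X1, measurable A -> Q' y A = Q y A}].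
Proof.
have [rho0 rho0E] := ex_semidirect_product nu1 P.
have [m2 m2E] := @ex_integral_kernel R _ _ X1 X2 nu1 setT P measurableT.
have [F TF mnF] := hnu1P.
have [|nu2 nu2E] := @ex_sigma_finite_measure R _ X2 m2.
  by exists F => // n; rewrite m2E; exact: mnF.
have [|rho rhoE] := @ex_sigma_finite_measure R _ (X1 * X2)%type rho0.
  exists (fun n => setT `*` F n); first by rewrite -setX_bigcupr -TF setXTT.
  move=> n; have [mF oo] := mnF n; split; first exact: measurableX.
  by rewrite rho0E.
have rho_rect A B : measurable A -> measurable B ->
    rho (A `*` B) = \int[nu1]_(x in A) P x B.
  by move=> mA mB; rewrite rhoE rho0E.
have nu2P B : nu2 B = kernel_act nu1 P B by rewrite nu2E m2E.
have rho_snd B : measurable B -> rho (setT `*` B) = nu2 B.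
  by move=> mB; rewrite nu2P rho_rect.
have [Q QE] := disintegration rho_snd hX1.
have rho_fst A : measurable A -> rho (A `*` setT) = nu1 A.
  (* The first marginal is [nu1] because [P x] has total mass 1. *)
  move=> mA; rewrite rho_rect//; under eq_integral do rewrite prob_kernel.
  by rewrite integral_cst// mul1e.
exists rho, nu2, Q; split.
  split.
  - by move=> A mA; have := rho_fst A mA; rewrite setXT.
  - by move=> B mB; have := rho_snd B mB; rewrite setTX.
  - by move=> A B mA mB; split; [exact: rho_rect|exact: QE].
  - by move=> B mB; rewrite -nu2P.
  - by move=> A mA; have := rho_fst A mA; rewrite QE.
move=> rho' nu2' Q' [fst' snd' dis' act1 act2].
have nuE B : measurable B -> nu2' B = nu2 B.
  by move=> mB; rewrite nu2P act1.
have rectE A B : measurable A -> measurable B -> rho (A `*` B) = rho' (A `*` B).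
  by move=> mA mB; have [h _] := dis' _ _ mA mB; rewrite rho_rect// -h.
split => //.
- by move=> C mC; apply/esym; apply: (measure_eq_rectangles rho_snd rectE).
(* [Q'] disintegrates [rho'] along [nu2']; these agree with [rho] and [nu2] where needed, so [Q] and
   [Q'] have the same integrals. *)
- apply: kernel_ae_unique => // A B mA mB.
  transitivity (rho (A `*` B)); last exact: QE.
  rewrite rectE//; have [_ h] := dis' _ _ mA mB; rewrite h.
  by apply: eq_measure_integral => C mC _; apply/esym/nuE.
Qed.
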